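(* Let $N\ge1$ and consider the $1$-parameter family $\mathcal{X}_t:=\{f_t(\mathbf{x})=0\}$, $t\in\mathbb{C}$, with $$f_0(\mathbf{x}):=\sum_{i=1}^{N-1}x_i^2+x_N^3+x_{N+1}^4,\qquad f_t(\mathbf{x}):=f_0(\mathbf{x})-3t^2x_Nx_{N+1}^2-2t^3x_{N+1}^3 .$$ Then, for generic $t\in\mathbb{C}$, $\mathcal{X}_t$ admits the unique singular point $\mathbf{0}\in f_t^{-1}(0)$, which is of type $D_5$.
   Context: $\mathbf{x}=(x_1,\ldots,x_{N+1})\in\mathbb{C}^{N+1}$. An isolated hypersurface singularity is of type $D_m$ ($m\ge4$) if it is equivalent, up to a local biholomorphic change of coordinates, to $\sum_{i=1}^{N-1}x_i^2+x_N^2x_{N+1}+x_{N+1}^{m-1}=0$ at the origin. *)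

(* Defs.v *)
From mathcomp Require Import all_boot all_order all_algebra.
From mathcomp Require Import all_classical all_reals all_analysis.
From mathcomp Require Import complex.
Set Implicit Arguments.
Unset Strict Implicit.
Unset Printing Implicit Defensive.
Import Order.TTheory GRing.Theory Num.Theory numFieldNormedType.Exports.
Local Open Scope classical_set_scope.
Local Open Scope ring_scope.

(* The field of complex numbers. Packing R[i] as a numClosedFieldType gives it,
   and the row vectors over it, the normed topology of numFieldNormedType; the
   bare type R[i] has no declared topology. The definitions below take an
   arbitrary numClosedFieldType C and are meant for C := Cplx R. *)
Definition Cplx (R : realType) : numClosedFieldType := R[i].

(* 1-based coordinates: the entries of x in C^{N+1} are crd x 1, ...,
   crd x N.+1. *)
Definition crd (C : Type) (N : nat) (x : 'rV[C]_N.+1) (k : nat) : C :=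
  x ord0 (inord k.-1).

(* "For generic t": on a nonempty Zariski-open subset of the affine line. *)
Definition generically (C : idomainType) (P : C -> Prop) : Prop :=
  exists2 q : {poly C}, q != 0 & forall t, ~~ root q t -> P t.

(* Differentiability is over C, hence complex differentiability. *)
Definition holomorphic_on (C : numClosedFieldType) (V W : normedModType C)
    (U : set V) (F : V -> W) : Prop :=
  forall x, U x -> differentiable F x.

(* phi restricts to a biholomorphic map from the open set U onto the open set
   U', with inverse psi; the values of phi and psi elsewhere are irrelevant. *)
Definition biholomorphism (C : numClosedFieldType) (V W : normedModType C)
    (U : set V) (U' : set W) (phi : V -> W) (psi : W -> V) : Prop :=
  [/\ open U /\ open U',
      holomorphic_on U phi /\ holomorphic_on U' psi,
      (forall x, U x -> U' (phi x)) /\ (forall y, U' y -> U (psi y)) &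
      (forall x, U x -> psi (phi x) = x) /\ (forall y, U' y -> phi (psi y) = y)].

Section Hypersurface.
Variables (C : numClosedFieldType) (n : nat).
Implicit Types (f g u : 'rV[C]_n -> C) (p q : 'rV[C]_n).

(* The points of {f = 0} at which all the partial derivatives of f vanish. *)
Definition singular_locus f : set 'rV[C]_n :=
  [set p | f p = 0 /\ forall i : 'I_n, 'D_(delta_mx ord0 i) f p = 0].

Definition isolated_singularity f p : Prop :=
  exists U : set 'rV[C]_n,
    [/\ open U, U p, holomorphic_on U f & singular_locus f `&` U = [set p]].

(* The hypersurface germs ({f = 0}, p) and ({g = 0}, q) agree up to a local
   biholomorphic change of coordinates phi. They are germs of complex spaces,
   so an equation matters only up to a unit: phi pulls the ideal (g) back to
   the ideal (f). *)
Definition germ_equivalent f p g q : Prop :=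
  exists (U U' : set 'rV[C]_n) (phi psi : 'rV[C]_n -> 'rV[C]_n) u,
    [/\ U p, phi p = q, biholomorphism U U' phi psi,
        holomorphic_on U u /\ (forall x, U x -> u x != 0) &
        forall x, U x -> f x = u x * g (phi x)].

End Hypersurface.

Definition D_form (C : numClosedFieldType) (N m : nat) (x : 'rV[C]_N.+1) : C :=
  \sum_(1 <= i < N) crd x i ^+ 2 + crd x N ^+ 2 * crd x N.+1
  + crd x N.+1 ^+ (m - 1).

Definition singularity_type_D (C : numClosedFieldType) (N m : nat)
    (f : 'rV[C]_N.+1 -> C) (p : 'rV[C]_N.+1) : Prop :=
  [/\ (4 <= m)%N, isolated_singularity f p
    & germ_equivalent f p (D_form m) 0].

Definition f0 (C : numClosedFieldType) (N : nat) (x : 'rV[C]_N.+1) : C :=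
  \sum_(1 <= i < N) crd x i ^+ 2 + crd x N ^+ 3 + crd x N.+1 ^+ 4.

Definition ft (C : numClosedFieldType) (N : nat) (t : C) (x : 'rV[C]_N.+1) : C :=
  f0 x - 3 * t ^+ 2 * crd x N * crd x N.+1 ^+ 2 - 2 * t ^+ 3 * crd x N.+1 ^+ 3.

(* Main.v *)
Require Import Defs.
From HB Require Import structures.
From mathcomp Require Import all_boot all_order all_algebra.
From mathcomp Require Import all_classical all_reals all_analysis.
From mathcomp Require Import complex.
From mathcomp Require Import ring lra.
Import Order.TTheory GRing.Theory Num.Theory numFieldNormedType.Exports.
Local Open Scope classical_set_scope.
Local Open Scope ring_scope.
Set Implicit Arguments.
Unset Strict Implicit.
Unset Printing Implicit Defensive.

(** Write a, b for the last two coordinates x_N, x_(N+1), and g for the part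
of f_t that depends on them, so that f_t is g plus squares of the other
coordinates.  The cubic part of g is (a - 2 t b) (a + t b)^2.  For t != 0 its
two linear factors differ, so g = 0 has at the origin a smooth branch tangent
to a = 2 t b and a cusp tangent to a = - t b, and these are the branches of
y^2 z + z^4 = z (y^2 + z^3).

The change of coordinates is obtained without any power series.  The quartic
g = 0 has a triple point, so a line of slope a / b = tau + 2 t through the
origin meets it in one further point, with b = - tau (tau + 3 t)^2; this
parametrizes the smooth branch near tau = 0.  In the coordinates (a, tau) the
cubic polynomial g in a therefore has an explicit linear factor, and
completing the square in the remaining quadratic factor gives g the form
unit * z (S^2 + unit * z^3).  The second unit is linear in z, so z is rational
in tau and in a square root om of that unit.  With (tau, om) as parameters, a
and b, the coordinates y and z of the normal form, and the square root of the
unit relating the equations are all rational functions, and the equivalence is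
one identity between them, param_normal_form.

The parameters thus provide two charts around the point tau = 0, om = 2 t, one
onto the given coordinates and one onto those of the normal form; the other
coordinates are only rescaled by the square root of the unit.  Both have
invertible Jacobian at the centre (source_gradients, target_gradients), so both
have holomorphic local inverses (local_inverse), and the required change of
coordinates is one chart composed with the inverse of the other (ft_germ_D5).

The inverse function theorem is proved over the complex numbers R[i] by
Newton's iteration with constant slope.  It needs strict differentiability at
the centre, which for rational functions follows from algebraic rules on
difference quotients (strict_gradient).

That the origin is the only singular point (ft_singular_locus) is a direct
computation with the partial derivatives of f_t. *)

(** * Completeness of the complex numbers *)

(** The limit is the supremum of the lower bounds u k - 2 c / 2 ^+ k: each of
them lies below each upper bound u k + 2 c / 2 ^+ k. *)
Lemma real_geometric_limit (R : realType) (u : nat -> R) (c : R) :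
  (forall k, `|u k.+1 - u k| <= c / 2 ^+ k) ->
  exists l, forall k, `|u k - l| <= 2 * c / 2 ^+ k.
Proof.
move=> uc.
have c0 : 0 <= c by have := le_trans (normr_ge0 _) (uc 0%N); rewrite expr0 divr1.
have b0 k : 0 <= 2 * c / 2 ^+ k by rewrite divr_ge0 ?mulr_ge0 ?exprn_ge0.
have dist k m : `|u (k + m)%N - u k| <= 2 * c / 2 ^+ k.
  suff: `|u (k + m)%N - u k| <= 2 * c / 2 ^+ k - 2 * c / 2 ^+ (k + m).
    by move=> /le_trans; apply; rewrite gerBl.
  elim: m => [|m IH]; first by rewrite addn0 !subrr normr0.
  have -> : u (k + m.+1)%N - u k
     = (u (k + m).+1 - u (k + m)%N) + (u (k + m)%N - u k) by rewrite addnS; ring.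
  apply: le_trans (ler_normD _ _) _.
  apply: le_trans (lerD (uc _) IH) _.
  rewrite addnS exprS le_eqVlt; apply/orP; left; apply/eqP; field.
  by rewrite !expf_neq0.
have below m k : u m - 2 * c / 2 ^+ m <= u k + 2 * c / 2 ^+ k.
  have [km|/ltnW mk] := leqP k m.
    have := dist k (m - k)%N; rewrite subnKC// ler_norml => /andP[_ h].
    by have := b0 m; lra.
  have := dist m (k - m)%N; rewrite subnKC// ler_norml => /andP[h _].
  by have := b0 k; lra.
pose A := range (fun k => u k - 2 * c / 2 ^+ k).
have A0 : A !=set0 by exists (u 0%N - 2 * c / 2 ^+ 0), 0%N.
exists (sup A) => k; rewrite ler_norml; apply/andP; split.
  have : sup A <= u k + 2 * c / 2 ^+ k.
    by apply: ge_sup => // _ [m _ <-]; exact: below.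
  by move=> h; lra.
have : u k - 2 * c / 2 ^+ k <= sup A.
  apply: sup_ubound; last by exists k.
  by exists (u 0%N + 2 * c / 2 ^+ 0) => _ [m _ <-]; exact: below.
by move=> h; lra.
Qed.

(** Completeness in the form used by the fixed point iteration, with an explicit
rate of convergence so that no limits of sequences in R[i] are taken. *)
Lemma complex_geometric_limit (R : realType) (u : nat -> Cplx R) (c : Cplx R) :
  (forall k, `|u k.+1 - u k| <= c / 2 ^+ k) ->
  exists l, forall k, `|u k - l| <= 4 * c / 2 ^+ k.
Proof.
move=> uc.
have cR : c = (complex.Re c)%:C%C.
  have := le_trans (normr_ge0 _) (uc 0%N); rewrite expr0 divr1 => c0.
  by rewrite RRe_real// ger0_real.
have pE k : (2 : Cplx R) ^+ k = (2 ^+ k)%:C%C.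
  by rewrite rmorphXn rmorphMn rmorph1.
have cE k : c / 2 ^+ k = (complex.Re c / 2 ^+ k)%:C%C.
  by rewrite pE {1}cR -fmorphV -rmorphM.
have nIm (z : R[i]) : `|complex.Im z|%:C%C <= `|z|.
  case: z => a b; rewrite normc_def/= lecR -sqrtr_sqr ler_wsqrtr // lerDr sqr_ge0 //.
have [a ha] : exists a, forall k, `|complex.Re (u k) - a| <= 2 * complex.Re c / 2 ^+ k.
  apply: real_geometric_limit => k; rewrite -lecR -cE.
  apply: le_trans (uc k); apply: le_trans (normc_ge_Re _).
  by rewrite raddfB.
have [b hb] : exists b, forall k, `|complex.Im (u k) - b| <= 2 * complex.Re c / 2 ^+ k.
  apply: real_geometric_limit => k; rewrite -lecR -cE.
  apply: le_trans (uc k); apply: le_trans (nIm _).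
  by rewrite raddfB.
exists (a +i* b)%C => k.
have -> : 4 * c / 2 ^+ k = (4 * complex.Re c / 2 ^+ k)%:C%C.
  by rewrite -!mulrA cE [in RHS]rmorphM rmorph_nat.
have -> : u k - (a +i* b)%C = (complex.Re (u k) - a)%:C%C + 'i%C * (complex.Im (u k) - b)%:C%C.
  by case: (u k) => x y; rewrite /=; simpc.
apply: le_trans (ler_normD _ _) _.
rewrite normrM.
have -> : `|'i%C : R[i]| = 1 by rewrite normc_def/= expr0n/= add0r expr1n sqrtr1.
rewrite mul1r.
have nR (x : R) : `|x%:C%C : R[i]| = `|x|%:C%C.
  by rewrite normc_def/= expr0n/= addr0 sqrtr_sqr.
by rewrite !nR -rmorphD/= lecR; have := ha k; have := hb k; lra.
Qed.

(** The order of R[i] is partial, so the usual archimedean statements do not apply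
to it directly; they are transported from R along the real part. *)
Lemma complex_archimedean (R : realType) (a c : Cplx R) :
  (forall k, `|a| <= c / 2 ^+ k) -> a = 0.
Proof.
move=> ac; apply/eqP; rewrite -normr_eq0; apply/eqP.
have cR : c = (complex.Re c)%:C%C.
  have := le_trans (normr_ge0 _) (ac 0%N); rewrite expr0 divr1 => c0.
  by rewrite RRe_real// ger0_real.
have aR : `|a| = (complex.Re `|a|)%:C%C by rewrite RRe_real// ger0_real.
have h k : complex.Re `|a| <= complex.Re c / 2 ^+ k.
  rewrite -lecR -aR; apply: le_trans (ac k) _.
  by rewrite {1}cR rmorphM fmorphV rmorphXn rmorph_nat.
have a0 : 0 <= complex.Re `|a| by rewrite -ler0c -aR.
rewrite aR; congr (_ %:C)%C; apply/eqP; rewrite eq_le a0 andbT.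
rewrite leNgt; apply/negP => ap.
pose n := Num.truncn (complex.Re c / complex.Re `|a|).
have := h n.+1; rewrite ler_pdivlMr ?exprn_gt0// leNgt => /negP; apply.
rewrite mulrC -ltr_pdivrMr//.
apply: lt_le_trans (truncnS_gt _) _.
by rewrite -natrX ler_nat ltnW// ltn_expl.
Qed.

(** * Norms of row vectors and Jacobian matrices *)

Lemma norm_entry_le (K : numFieldType) n (v : 'rV[K]_n) (i : 'I_n) :
  `|v ord0 i| <= `|v|.
Proof.
rewrite -[leRHS]/(mx_norm v) mx_normE.
have -> : `|v ord0 i| = `|v (ord0 : 'I_1, i).1 (ord0 : 'I_1, i).2| by [].
by rewrite -[leLHS]nngE num_le; exact: le_bigmax.
Qed.

Lemma norm_row_le (K : numFieldType) n (v : 'rV[K]_n) (c : K) :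
  0 <= c -> (forall i, `|v ord0 i| <= c) -> `|v| <= c.
Proof.
move=> c0 vc; have [/eqP ->//|v0] := boolP (`|v| == 0).
by have [[i j] vE] := mx_norm_neq0 v0; rewrite [leLHS]vE; rewrite /= (ord1 i).
Qed.

Lemma norm_mulmx_le (K : numFieldType) n m (A : 'M[K]_(n, m)) :
  exists2 c, 0 < c & forall v : 'rV_n, `|v *m A| <= c * `|v|.
Proof.
exists (1 + \sum_i \sum_j `|A i j|) => [|v].
  by rewrite ltr_pwDl// sumr_ge0 // => i _; rewrite sumr_ge0.
have s0 (i : 'I_n) : 0 <= \sum_j `|A i j| by rewrite sumr_ge0.
apply: norm_row_le => [|j]; first by rewrite mulr_ge0// addr_ge0// sumr_ge0.
rewrite mxE; apply: le_trans (ler_norm_sum _ _ _) _.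
rewrite mulrDl mul1r mulr_suml; apply: ler_wpDl => //.
apply: ler_sum => i _; rewrite normrM mulrC ler_pM// ?norm_entry_le//.
by rewrite (bigD1 j)//= lerDl sumr_ge0.
Qed.

Lemma near_dist_lt (K : numFieldType) (V : normedModType K) (p : V) (e : K) :
  0 < e -> \forall x \near p, `|x - p| < e.
Proof.
by move=> e0; apply/nbhs_normP; exists e => //= x; rewrite /ball_ /= distrC.
Qed.

Lemma mulmx_row_continuous (K : numFieldType) n m (A : 'M[K]_(n, m)) :
  continuous (fun v : 'rV[K]_n => v *m A).
Proof.
move=> v; have [c c0 Ac] := norm_mulmx_le A.
apply/(@cvgrPdist_le _ _ _ _ (nbhs_filter v)) => e e0.
have /(near_dist_lt v) : 0 < c^-1 * e by rewrite mulr_gt0// invr_gt0.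
apply: (@filterS _ _ (nbhs_filter _)) => w vw; rewrite -mulmxBl; apply: le_trans (Ac _) _.
by rewrite -ler_pdivlMl// distrC ltW.
Qed.

(** In a partially ordered field, a b / (a + b) replaces the minimum of a and b. *)
Lemma lower_bound_pos (K : numFieldType) (a b : K) : 0 < a -> 0 < b ->
  exists2 m, 0 < m & m < a /\ m < b.
Proof.
move=> a0 b0; have ab0 : 0 < a + b by exact: addr_gt0.
exists (a * b / (a + b)); first by rewrite divr_gt0 ?mulr_gt0.
by rewrite !ltr_pdivrMr// ltr_pM2l// ltrDr mulrC ltr_pM2l// ltrDl.
Qed.

Lemma near_ball (K : numFieldType) (V : normedModType K) (p : V)
    (P : V -> Prop) : (\forall x \near p, P x) ->
  exists2 r, 0 < r & forall x, `|x - p| < r -> P x.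
Proof.
move=> /nbhs_normP[r /= r0 rP]; exists r => // x xr; apply: rP.
by rewrite /ball_/= distrC.
Qed.

Lemma near_pair_ball (K : numFieldType) (V : normedModType K) (p : V)
    (P : V * V -> Prop) : (\forall z \near (p, p), P z) ->
  exists2 r, 0 < r & forall x y, `|x - p| < r -> `|y - p| < r -> P (x, y).
Proof.
move=> [[A B] /= [/near_ball[a a0 aA] /near_ball[b b0 bB]] AB].
have [r r0 [ra rb]] := lower_bound_pos a0 b0; exists r => // x y xr yr.
by apply: AB; split => /=; [apply: aA; exact: lt_trans ra|apply: bB; exact: lt_trans rb].
Qed.

Definition has_jacobian (K : numFieldType) n m (f : 'rV[K]_n -> 'rV[K]_m) p
    (J : 'M[K]_(n, m)) : Prop :=
  forall e, 0 < e -> \forall x \near p, `|f x - f p - (x - p) *m J| <= e * `|x - p|.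

(** Unlike has_jacobian, both points move; this makes f close to its linear part
in the Lipschitz sense near p, as a contraction argument requires. *)
Definition strict_jacobian (K : numFieldType) n m (f : 'rV[K]_n -> 'rV[K]_m) (p : 'rV[K]_n)
    (J : 'M[K]_(n, m)) : Prop :=
  forall e, 0 < e -> \forall z \near (p, p),
    `|f z.1 - f z.2 - (z.1 - z.2) *m J| <= e * `|z.1 - z.2|.

(** The term 'd f p is defined by choice; exhibiting one linear approximation
suffices because such an approximation is unique. *)
Lemma linear_approx_differentiable (K : numFieldType) (V W : normedModType K)
    (f : V -> W) (L : {linear V -> W}) p : continuous L ->
  (forall e, 0 < e -> \forall x \near p, `|f x - f p - L (x - p)| <= e * `|x - p|) ->
  differentiable f p /\ 'd f p = L :> (V -> W).
Proof.
move=> cL fL.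
have fo : f \o shift p = cst (f p) + L +o_ 0 id.
  apply/eqaddoP => e e0; have := fL e e0; rewrite (near_shift 0 p).
apply: filterS => h /=; rewrite subr0 addrK.
  rewrite /= -![(_ + _ : _ -> _) _]/(_ + _) -![(- _ : _ -> _) _]/(- _) /=.
  by rewrite opprD addrA.
have dfE := diff_unique cL fo.
split => //; apply/diff_locallyP; rewrite dfE; split => //.
Qed.

Lemma has_jacobian_differentiable (K : numFieldType) n m
    (f : 'rV[K]_n -> 'rV[K]_m) p J : has_jacobian f p J -> differentiable f p.
Proof.
move=> fJ; have cJ : continuous (mulmxr J : {linear 'rV[K]_n -> 'rV[K]_m}).
  exact: mulmx_row_continuous.
by have [] := linear_approx_differentiable cJ fJ.
Qed.

(** * The inverse function theorem *)

(** The iterates of x0 move by at most c / 2 ^+ k at step k, where c is the first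
displacement, so they and their limit stay within 4 c of x0. *)
Lemma contraction_fixed_point (R : realType) n (T : 'rV[Cplx R]_n -> 'rV[Cplx R]_n)
    (x0 : 'rV[Cplx R]_n) (s : Cplx R) :
  (forall x y, `|x - x0| < s -> `|y - x0| < s -> `|T x - T y| <= `|x - y| / 2) ->
  4 * `|T x0 - x0| < s ->
  exists2 x, `|x - x0| < s & T x = x.
Proof.
set c := `|T x0 - x0| => Tc cs.
have c0 : 0 <= c by exact: normr_ge0.
have p0 k : 0 < (2 : Cplx R) ^+ k by rewrite exprn_gt0.
pose u k := iter k T x0.
have s0 : 0 < s by apply: le_lt_trans cs; rewrite mulr_ge0.
(* The first bound keeps all iterates in the domain of the contraction. *)
have step k : `|u k - x0| <= 2 * c - 2 * c / 2 ^+ k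
    /\ `|u k.+1 - u k| <= c / 2 ^+ k.
  elim: k => [|k [IH1 IH2]].
    by rewrite /u/= !subrr expr0 !divr1 subrr normr0 lexx.
  have near_x0 : `|u k.+1 - x0| <= 2 * c - 2 * c / 2 ^+ k.+1.
    have -> : u k.+1 - x0 = (u k.+1 - u k) + (u k - x0) by rewrite subrKA.
    apply: le_trans (ler_normD _ _) _.
    apply: le_trans (lerD IH2 IH1) _.
    rewrite exprS le_eqVlt; apply/orP; left; apply/eqP.
    by field; rewrite gt_eqF.
  have small (x : Cplx R) j : x <= 2 * c - 2 * c / 2 ^+ j -> x < s.
    move=> /le_lt_trans; apply; apply: le_lt_trans cs.
    rewrite lerBlDr; apply: (@le_trans _ _ (4 * c)).
      by rewrite ler_wpM2r// ler_nat.
    by rewrite lerDl divr_ge0 ?mulr_ge0// ltW.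
  split => //.
  rewrite -[u k.+2]/(T (u k.+1)) -[in X in _ - X]/(T (u k)).
  apply: le_trans (Tc _ _ (small _ _ near_x0) (small _ _ IH1)) _.
  rewrite exprSr invfM mulrA ler_pM2r ?invr_gt0//.
have lim_entry i : exists l, forall k, `|u k ord0 i - l| <= 4 * c / 2 ^+ k.
  apply: complex_geometric_limit => k.
  apply: le_trans (step k).2; apply: le_trans (norm_entry_le _ i).
  by rewrite !mxE.
have [l ul] := choice lim_entry.
pose x := (\row_i l i : 'rV[Cplx R]_n).
have ux k : `|u k - x| <= 4 * c / 2 ^+ k.
  apply: norm_row_le => [|i]; first by rewrite divr_ge0 ?mulr_ge0// ltW.
  by rewrite !mxE.
have xs : `|x - x0| < s.
  by rewrite distrC; apply: le_lt_trans cs; have := ux 0%N; rewrite expr0 divr1.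
have us k : `|u k - x0| < s.
  apply: le_lt_trans (step k).1 _; apply: le_lt_trans cs.
  rewrite lerBlDr; apply: (@le_trans _ _ (4 * c)).
    by rewrite ler_wpM2r// ler_nat.
  by rewrite lerDl divr_ge0 ?mulr_ge0// ltW.
exists x => //; apply/eqP; rewrite -subr_eq0; apply/eqP/rowP => i.
rewrite [RHS]mxE; apply: (@complex_archimedean _ _ (8 * c)) => k.
apply: le_trans (norm_entry_le _ i) _.
have -> : T x - x = (T x - T (u k)) + (u k.+1 - x) by rewrite /= subrKA.
apply: le_trans (ler_normD _ _) _.
apply: (@le_trans _ _ ((4 * c / 2 ^+ k) / 2 + 4 * c / 2 ^+ k.+1)).
  apply: lerD (ux _); apply: le_trans (Tc _ _ xs (us k)) _.
  by rewrite ler_pM2r ?invr_gt0// distrC.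
rewrite exprSr.
have -> : 4 * c / 2 ^+ k / 2 + 4 * c / (2 ^+ k * 2) = 4 * c / 2 ^+ k.
  by field; rewrite gt_eqF.
by rewrite ler_wpM2r ?invr_ge0 ?ler_wpM2r ?ler_nat// ltW.
Qed.

(** On a kernel vector of J the function f varies less than linearly, which the
lower bound on its variation excludes. *)
Lemma nonsingular_of_lower_bound (K : numFieldType) n (f : 'rV[K]_n -> 'rV[K]_n) x J c d :
  0 < c -> 0 < d ->
  (forall y, `|y - x| < d -> `|y - x| <= c * `|f y - f x|) ->
  has_jacobian f x J -> J \in unitmx.
Proof.
move=> c0 d0 lb fJ; rewrite -row_free_unit; apply: inj_row_free => v vJ.
apply/eqP; rewrite -normr_eq0; apply/eqP.
have [r r0 rP] := near_ball (fJ (2 * c)^-1 ltac:(by rewrite invr_gt0 mulr_gt0)).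
apply/eqP; apply: contraT => v0.
have vp : 0 < `|v| by rewrite lt0r v0 normr_ge0.
have [m m0 [mr md]] := lower_bound_pos r0 d0.
(* A point at distance m from x in the direction of the kernel vector v. *)
pose y := x + (m / `|v|) *: v.
have yx : y - x = (m / `|v|) *: v by rewrite /y addrC addKr.
have nyx : `|y - x| = m.
  by rewrite yx normrZ normrM normfV normr_id (gtr0_norm m0) divfK.
have := rP y; rewrite nyx yx -scalemxAl vJ scaler0 subr0 => /(_ mr) h1.
have := lb y; rewrite nyx => /(_ md) h2.
have : m <= m / 2.
  apply: le_trans h2 _; apply: le_trans (ler_wpM2l (ltW c0) h1) _.
  rewrite le_eqVlt; apply/orP; left; apply/eqP; field.
  by rewrite gt_eqF.
by rewrite ler_pdivlMr// ger_pMr// (ler_nat _ 2 1).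
Qed.

(** Multiplying phi by the inverse of M makes it a perturbation of the identity
with Lipschitz constant 1/2.  Such a map is injective with Lipschitz inverse, and
it is open because phi x = y is a fixed point equation for a contraction.  The
derivative of the inverse at phi x is the inverse of the Jacobian at x, since
the error term is controlled by the Lipschitz bound.  The radius may be
shrunk freely, which allows two charts to share one domain. *)
Lemma local_inverse (R : realType) n (phi : 'rV[Cplx R]_n -> 'rV[Cplx R]_n) p M :
  M \in unitmx -> strict_jacobian phi p M ->
  (\forall x \near p, exists J, has_jacobian phi x J) ->
  exists2 r0, 0 < r0 & forall r, 0 < r -> r <= r0 ->
    exists psi, biholomorphism (ball p r) (phi @` ball p r) phi psi.
Proof.
move=> uM sM /near_ball[r1 r1_gt0 dphi].
have [c c0 cM] := norm_mulmx_le (invmx M).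
have [r2 r2_gt0 sphi] := near_pair_ball (sM (c^-1 / 2) ltac:(by rewrite divr_gt0 ?invr_gt0)).
have [r0 r0_gt0 [/ltW r01 /ltW r02]] := lower_bound_pos r1_gt0 r2_gt0.
exists r0 => // r r_gt0 rr0; set B := ball p r.
have BE x : B x <-> `|x - p| < r by rewrite /B -ball_normE /ball_/= distrC.
have contr x y : B x -> B y ->
    `|(x - y) - (phi x - phi y) *m invmx M| <= `|x - y| / 2.
  move=> /BE xB /BE yB.
  have -> : (x - y) - (phi x - phi y) *m invmx M
      = - ((phi x - phi y - (x - y) *m M) *m invmx M).
    by rewrite [X in _ = - X]mulmxBl mulmxK// opprB.
  rewrite normrN; apply: le_trans (cM _) _.
  have := sphi x y (lt_le_trans xB (le_trans rr0 r02)) (lt_le_trans yB (le_trans rr0 r02)).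
  move=> /(ler_wpM2l (ltW c0))/le_trans; apply.
  rewrite le_eqVlt; apply/orP; left; apply/eqP => /=; field.
  by rewrite gt_eqF.
have expand x y : B x -> B y -> `|x - y| <= 2 * c * `|phi x - phi y|.
  move=> xB yB; have := contr x y xB yB.
  move=> h; have : `|x - y| <= c * `|phi x - phi y| + `|x - y| / 2.
    apply: le_trans (lerD (cM _) h).
    by apply: le_trans (ler_normD _ _); rewrite [_ *m _ + _]addrC subrK.
  rewrite -lerBlDr.
  have -> : `|x - y| - `|x - y| / 2 = `|x - y| / 2 by field.
  by rewrite ler_pdivrMr// mulrAC [_ * 2]mulrC.
have inj x y : B x -> B y -> phi x = phi y -> x = y.
  move=> xB yB xy; apply/eqP; rewrite -subr_eq0 -normr_le0.
  by have := expand x y xB yB; rewrite xy subrr normr0 mulr0.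
pose psi y := xget p [set x | B x /\ phi x = y].
have psiP y : (phi @` B) y -> B (psi y) /\ phi (psi y) = y.
  move=> [x Bx xy]; rewrite /psi.
  by apply: (@xgetPex _ p [set x | B x /\ phi x = y]); exists x.
have psiK x : B x -> psi (phi x) = x.
  move=> Bx; have [|B1 E1] := psiP (phi x); first by exists x.
  exact: inj.
have openB : open B by exact: ball_open.
(* A point y close to phi x0 is attained near x0: the fixed points of T are the
   solutions of phi x = y. *)
have onto x0 y s : (forall x, `|x - x0| < s -> B x) -> B x0 ->
    4 * (c * `|y - phi x0|) < s -> (phi @` B) y.
  move=> sB Bx0 ys; pose T x := x - (phi x - y) *m invmx M.
  have [] := @contraction_fixed_point R n T x0 s.
  - move=> x x' xs xs'.
    have -> : T x - T x' = (x - x') - (phi x - phi x') *m invmx M.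
      rewrite /T !mulmxBl; move: (_ *m _) (_ *m _) (_ *m _) => a b d.
      by apply/rowP => i; rewrite !mxE; ring.
    by apply: contr; apply: sB.
  - apply: le_lt_trans ys; rewrite ler_pM2l//.
    have -> : T x0 - x0 = (y - phi x0) *m invmx M.
      by rewrite /T addrAC subrr add0r -mulNmx opprB.
    exact: cM.
  move=> x xs /eqP; rewrite subr_eq -subr_eq0 opprD addrA subrr sub0r oppr_eq0.
  move=> /eqP Tx; exists x; first exact: sB.
  apply/eqP; rewrite -subr_eq0.
  by rewrite -(mulmxKV uM (phi x - y)) Tx mul0mx.
have ballin x0 : B x0 -> exists2 s, 0 < s & forall x, `|x - x0| < s -> B x.
  by move=> Bx0; apply: near_ball; exact: open_nbhs_nbhs.
have openB' : open (phi @` B).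
  rewrite openE => _ [x0 Bx0 <-]; have [s s0 sB] := ballin x0 Bx0.
  have /(near_dist_lt (phi x0)) : 0 < s / (4 * c) by rewrite divr_gt0 ?mulr_gt0.
  apply: filterS => y ys; apply: (onto x0 y s) => //.
  by rewrite mulrA mulrC -ltr_pdivlMr// mulr_gt0.
exists psi; split; [by []| |by split=> [x Bx|y /psiP[]//]; [exists x]
  |by split=> [x /psiK|y /psiP[]]].
split=> [x /BE xB|_ [x0 Bx0 <-]].
  have [J fJ] := dphi x (lt_le_trans xB (le_trans rr0 r01)).
  exact: has_jacobian_differentiable fJ.
have [s s0 sB] := ballin x0 Bx0.
have [J fJ] : exists J, has_jacobian phi x0 J.
  by apply: dphi; move/BE: Bx0 => /lt_le_trans; apply; exact: le_trans r01.
have uJ : J \in unitmx.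
  apply: (@nonsingular_of_lower_bound _ _ phi x0 J (2 * c) s) => //.
    by rewrite mulr_gt0.
  by move=> y /sB By; exact: expand.
apply: (@has_jacobian_differentiable _ _ _ _ _ (invmx J)) => e e0.
have [d d0 dJ] := norm_mulmx_le (invmx J).
have [s1 s10 fs] := near_ball (fJ (e / (2 * c * d))
  ltac:(by rewrite divr_gt0 ?mulr_gt0)).
have nbB' : \forall y \near phi x0, (phi @` B) y.
  by apply: open_nbhs_nbhs; split => //; exists x0.
have /(near_dist_lt (phi x0)) : 0 < s1 / (2 * c) by rewrite divr_gt0 ?mulr_gt0.
apply: filterS2 nbB' => y yB' ys.
have [Bx xy] := psiP y yB'; set x := psi y in Bx xy *.
rewrite psiK//.
have xd := expand x x0 Bx Bx0; rewrite xy in xd.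
have xs1 : `|x - x0| < s1.
  by apply: le_lt_trans xd _; rewrite mulrC -ltr_pdivlMr// mulr_gt0.
have := fs x xs1; rewrite xy => h.
have -> : x - x0 - (y - phi x0) *m invmx J
    = - ((y - phi x0 - (x - x0) *m J) *m invmx J).
  by rewrite [X in _ = - X]mulmxBl mulmxK// opprB.
rewrite normrN; apply: le_trans (dJ _) _.
apply: le_trans (ler_wpM2l (ltW d0) h) _.
apply: (@le_trans _ _ (e / (2 * c) * `|x - x0|)).
  rewrite le_eqVlt; apply/orP; left; apply/eqP; field.
  by rewrite !gt_eqF.
apply: le_trans (ler_wpM2l _ xd) _; first by rewrite ltW// divr_gt0// mulr_gt0.
by rewrite mulrA divfK// gt_eqF// mulr_gt0.
Qed.

(** * Strict differentiability of rational functions *)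

(** The linear form with gradient g. *)
Definition row_form (K : numFieldType) n (g : 'cV[K]_n) (h : 'rV[K]_n) : K :=
  (h *m g) ord0 ord0.

Fact row_form_linear (K : numFieldType) n (g : 'cV[K]_n) : linear (row_form g).
Proof. by move=> a u v; rewrite /row_form mulmxDl -scalemxAl !mxE. Qed.

HB.instance Definition _ (K : numFieldType) n (g : 'cV[K]_n) :=
  GRing.isLinear.Build K 'rV[K]_n K _ (row_form g) (row_form_linear g).

Lemma row_formE (K : numFieldType) n (i : 'I_n) (v : 'rV[K]_n) :
  row_form (delta_mx i ord0) v = v ord0 i.
Proof. by rewrite /row_form -colE mxE. Qed.

Lemma row_form_gradD (K : numFieldType) n (g g' : 'cV[K]_n) v :
  row_form (g + g') v = row_form g v + row_form g' v.
Proof. by rewrite /row_form mulmxDr mxE. Qed.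

Lemma row_form_gradZ (K : numFieldType) n a (g : 'cV[K]_n) v :
  row_form (a *: g) v = a * row_form g v.
Proof. by rewrite /row_form -scalemxAr mxE. Qed.

Lemma row_form_gradN (K : numFieldType) n (g : 'cV[K]_n) v :
  row_form (- g) v = - row_form g v.
Proof. by rewrite /row_form mulmxN mxE. Qed.

Lemma row_form_grad0 (K : numFieldType) n (v : 'rV[K]_n) : row_form 0 v = 0.
Proof. by rewrite /row_form mulmx0 mxE. Qed.

Lemma row_form_grad_sum (K : numFieldType) n (I : Type) (r : seq I) (P : pred I)
    (g : I -> 'cV[K]_n) v :
  row_form (\sum_(i <- r | P i) g i) v = \sum_(i <- r | P i) row_form (g i) v.
Proof. by rewrite /row_form mulmx_sumr summxE. Qed.

Definition row_form_gradE := (row_form_gradD, row_form_gradZ, row_form_gradN,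
  row_form_grad0, row_formE).

(** Caratheodory's form of strict differentiability: the difference of two values
is linear in the difference of the points, with a slope Q continuous at (p, p).
Slopes of sums, products and inverses are given by algebraic identities. *)
Definition strict_gradient (K : numFieldType) n (f : 'rV[K]_n -> K)
    (p : 'rV[K]_n) (g : 'cV[K]_n) : Prop :=
  exists Q : 'rV[K]_n * 'rV[K]_n -> 'cV[K]_n,
    (\forall z \near (p, p), f z.1 - f z.2 = ((z.1 - z.2) *m Q z) ord0 ord0)
    /\ forall i, Q z i ord0 @[z --> (p, p)] --> g i ord0.

Lemma strict_gradient_estimate (K : numFieldType) n (f : 'rV[K]_n -> K) p g :
  strict_gradient f p g -> forall e, 0 < e -> \forall z \near (p, p),
    `|f z.1 - f z.2 - ((z.1 - z.2) *m g) ord0 ord0| <= e * `|z.1 - z.2|.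
Proof.
move=> [Q [fQ Qg]] e e0.
have en0 : 0 < e / n.+1%:R by rewrite divr_gt0.
have Qe : \forall z \near (p, p), forall i, `|g i ord0 - Q z i ord0| <= e / n.+1%:R.
  apply: (@filter_forall _ _ (fun i z => `|g i ord0 - Q z i ord0| <= e / n.+1%:R)
    (nbhs (p, p))) => i.
  have h := @cvgr_dist_le _ _ _ (nbhs (p, p)) _ _ _ (Qg i) _ en0; exact: h.
apply: filterS2 fQ Qe => -[x y] /= -> Qe.
rewrite !mxE -sumrB; apply: le_trans (ler_norm_sum _ _ _) _.
apply: (@le_trans _ _ (\sum_(i < n) `|x - y| * (e / n.+1%:R))).
  apply: ler_sum => i _; rewrite -mulrBr normrM distrC ler_pM//.
  exact: norm_entry_le.
rewrite sumr_const card_ord -[_ *+ n]mulr_natr -mulrA [leLHS]mulrC.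
rewrite ler_wpM2r// mulrAC -mulrA ler_piMr ?(ltW e0)//.
by rewrite ler_pdivrMr// mul1r ler_nat.
Qed.

Lemma strict_gradient_diff (K : numFieldType) n (f : 'rV[K]_n -> K) p g :
  strict_gradient f p g ->
  differentiable f p /\ 'd f p = row_form g :> ('rV[K]_n -> K).
Proof.
move=> fg; apply: (@linear_approx_differentiable _ _ _ f (row_form g)).
  apply/linear_bounded_continuous/linear_boundedP.
  have [c c0 gc] := norm_mulmx_le g; near=> M; move=> x.
  apply: le_trans (norm_entry_le _ ord0) _; apply: le_trans (gc x) _.
  rewrite ler_wpM2r//; near: M; apply: nbhs_pinfty_ge; exact: gtr0_real.
move=> e e0; have := strict_gradient_estimate fg e0.
move=> /near_pair_ball[r r0 rP]; have := near_dist_lt p r0.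
by apply: filterS => x xp; apply: (rP x p); rewrite ?subrr ?normr0.
Unshelve. all: by end_near. Qed.

(** Continuity of f at p along either projection; the rules for products and
inverses evaluate the factors of their slopes at one of the two points. *)
Lemma strict_gradient_cvg1 (K : numFieldType) n (f : 'rV[K]_n -> K) p g :
  strict_gradient f p g -> f z.1 @[z --> (p, p)] --> f p.
Proof.
move=> /strict_gradient_diff[/differentiable_continuous fc _].
by apply: cvg_comp; [exact: cvg_fst|exact: fc].
Qed.

Lemma strict_gradient_cvg2 (K : numFieldType) n (f : 'rV[K]_n -> K) p g :
  strict_gradient f p g -> f z.2 @[z --> (p, p)] --> f p.
Proof.
move=> /strict_gradient_diff[/differentiable_continuous fc _].
by apply: cvg_comp; [exact: cvg_snd|exact: fc].
Qed.

Section StrictGradientRules.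
Variables (K : numFieldType) (n : nat) (p : 'rV[K]_n).
Implicit Types (f : 'rV[K]_n -> K) (g : 'cV[K]_n).

Lemma strict_gradient_cst (a : K) : strict_gradient (fun=> a) p 0.
Proof.
exists (fun=> 0); split => [|i]; last exact: cvg_cst.
by apply: (@nearW _ (nbhs (p, p)) _ _) => z; rewrite mulmx0 mxE subrr.
Qed.

Lemma strict_gradient_coord (j : 'I_n) :
  strict_gradient (fun x => x ord0 j) p (delta_mx j ord0).
Proof.
exists (fun=> delta_mx j ord0); split => [|i]; last exact: cvg_cst.
by apply: (@nearW _ (nbhs (p, p)) _ _) => z; rewrite -colE !mxE.
Qed.

Lemma strict_gradientD f1 g1 f2 g2 :
  strict_gradient f1 p g1 -> strict_gradient f2 p g2 ->
  strict_gradient (fun x => f1 x + f2 x) p (g1 + g2).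
Proof.
move=> [Q1 [E1 L1]] [Q2 [E2 L2]]; exists (fun z => Q1 z + Q2 z); split=> [|i].
  apply: filterS2 E1 E2 => z E1 E2.
  by rewrite mulmxDr mxE -E1 -E2; ring.
rewrite mxE; under eq_fun do rewrite mxE; exact: cvgD.
Qed.

Lemma strict_gradientM f1 g1 f2 g2 :
  strict_gradient f1 p g1 -> strict_gradient f2 p g2 ->
  strict_gradient (fun x => f1 x * f2 x) p (f1 p *: g2 + f2 p *: g1).
Proof.
move=> s1 s2; have c1 := strict_gradient_cvg1 s1; have c2 := strict_gradient_cvg2 s2.
case: s1 s2 => [Q1 [E1 L1]] [Q2 [E2 L2]].
exists (fun z => f1 z.1 *: Q2 z + f2 z.2 *: Q1 z); split=> [|i].
  apply: filterS2 E1 E2 => z E1 E2.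
  by rewrite mulmxDr mxE -!scalemxAr [X in _ = X + _]mxE [X in _ = _ + X]mxE -E1 -E2; ring.
rewrite !mxE; under eq_fun do rewrite !mxE.
by apply: cvgD; apply: cvgM.
Qed.

Lemma strict_gradientN f g : strict_gradient f p g ->
  strict_gradient (fun x => - f x) p (- g).
Proof.
move=> /(strict_gradientM (strict_gradient_cst (-1))).
rewrite scaler0 addr0 scaleN1r.
by under eq_fun do rewrite mulN1r.
Qed.

Lemma strict_gradientV f g : f p != 0 -> strict_gradient f p g ->
  strict_gradient (fun x => (f x)^-1) p (- (f p) ^- 2 *: g).
Proof.
move=> fp s; have c1 := strict_gradient_cvg1 s; have c2 := strict_gradient_cvg2 s.
case: s => [Q [E L]].
exists (fun z => - ((f z.1)^-1 * (f z.2)^-1) *: Q z); split=> [|i].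
  have n1 : \forall z \near (p, p), f z.1 != 0.
    by have h := @cvgr_neq0 _ _ _ (nbhs (p, p)) _ _ _ c1 fp; exact: h.
  have n2 : \forall z \near (p, p), f z.2 != 0.
    by have h := @cvgr_neq0 _ _ _ (nbhs (p, p)) _ _ _ c2 fp; exact: h.
  apply: filterS3 E n1 n2 => z E z1 z2.
  by rewrite -scalemxAr mxE -E; field; rewrite z1 z2.
rewrite !mxE; under eq_fun do rewrite !mxE.
apply: cvgM => //; apply: cvgN; rewrite expr2 invfM.
by apply: cvgM; apply: cvgV.
Qed.

Lemma strict_gradientX f g k : strict_gradient f p g ->
  strict_gradient (fun x => f x ^+ k) p ((k%:R * f p ^+ k.-1) *: g).
Proof.
move=> s; elim: k => [|k IH].
  rewrite mul0r scale0r; exact: strict_gradient_cst.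
have := strict_gradientM s IH.
under eq_fun do rewrite -exprS.
rewrite scalerA -scalerDl [_ k.+1.-1]/=; congr strict_gradient; congr (_ *: _).
by case: k {IH} => [|k] /=; rewrite ?expr0 ?exprS -natr1; ring.
Qed.

Lemma strict_gradient_sum (I : Type) (r : seq I) (P : pred I)
    (f_ : I -> 'rV[K]_n -> K) (g_ : I -> 'cV[K]_n) :
  (forall i, P i -> strict_gradient (f_ i) p (g_ i)) ->
  strict_gradient (fun x => \sum_(i <- r | P i) f_ i x) p (\sum_(i <- r | P i) g_ i).
Proof.
move=> s; elim: r => [|i r IH].
  rewrite big_nil; under eq_fun do rewrite big_nil; exact: strict_gradient_cst.
rewrite big_cons; under eq_fun do rewrite big_cons.
by case: ifP => [/s si|_ //]; exact: strict_gradientD.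
Qed.

End StrictGradientRules.

Lemma strict_jacobian_entries (K : numFieldType) n m (f : 'rV[K]_n -> 'rV[K]_m) p J :
  (forall j, strict_gradient (fun x => f x ord0 j) p (col j J)) ->
  strict_jacobian f p J.
Proof.
move=> fJ e e0.
have : \forall z \near (p, p), forall j, `|f z.1 ord0 j - f z.2 ord0 j
    - ((z.1 - z.2) *m col j J) ord0 ord0| <= e * `|z.1 - z.2|.
  apply: (@filter_forall _ _ (fun j z => `|f z.1 ord0 j - f z.2 ord0 j
    - ((z.1 - z.2) *m col j J) ord0 ord0| <= e * `|z.1 - z.2|) (nbhs (p, p))) => j.
  have h := strict_gradient_estimate (fJ j) e0; exact: h.
apply: filterS => z zP; apply: norm_row_le => [|j]; first by rewrite mulr_ge0// ltW.
by have := zP j; rewrite colE mulmxA -colE !mxE.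
Qed.

Lemma strict_jacobian_has (K : numFieldType) n m (f : 'rV[K]_n -> 'rV[K]_m) p J :
  strict_jacobian f p J -> has_jacobian f p J.
Proof.
move=> fJ e e0; have /near_pair_ball[r r0 rP] := fJ e e0.
by apply: filterS (near_dist_lt p r0) => x xp; apply: (rP x p); rewrite ?subrr ?normr0.
Qed.

Lemma strict_gradient_near_neq0 (K : numFieldType) n (f : 'rV[K]_n -> K) p g :
  strict_gradient f p g -> f p != 0 -> \forall x \near p, f x != 0.
Proof.
move=> /strict_gradient_diff[/differentiable_continuous fc _] fp.
by have h := @cvgr_neq0 _ _ _ (nbhs p) _ _ _ fc fp; exact: h.
Qed.

(** The inverse function theorem for a map given by strictly differentiable
entries, invertibility of the Jacobian being tested on its kernel. *)
Lemma local_inverse_entries (R : realType) n (phi : 'rV[Cplx R]_n -> 'rV[Cplx R]_n)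
    p (g : 'I_n -> 'cV[Cplx R]_n) :
  (forall j, strict_gradient (fun x => phi x ord0 j) p (g j)) ->
  (forall v, (forall j, row_form (g j) v = 0) -> v = 0) ->
  (\forall x \near p, forall j, exists g', strict_gradient (fun x => phi x ord0 j) x g') ->
  exists2 r0, 0 < r0 & forall r, 0 < r -> r <= r0 ->
    exists psi, biholomorphism (ball p r) (phi @` ball p r) phi psi.
Proof.
move=> sg g0 sphi; pose M := \matrix_(i, j) g j i ord0.
have colM j : col j M = g j by apply/colP => i; rewrite !mxE.
apply: (@local_inverse R n phi p M).
- rewrite -row_free_unit; apply: inj_row_free => v vM; apply: g0 => j.
  by rewrite /row_form -colM colE mulmxA vM mul0mx mxE.
- by apply: strict_jacobian_entries => j; rewrite colM.
apply: filterS sphi => x /choice[g' sg'].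
exists (\matrix_(i, j) g' j i ord0).
apply: strict_jacobian_has; apply: strict_jacobian_entries => j.
by rewrite (_ : col _ _ = g' j)//; apply/colP => i; rewrite !mxE.
Qed.

(** * The singular locus *)

Lemma strict_gradient_crd (C : numClosedFieldType) N (p : 'rV[C]_N.+1) k :
  strict_gradient (fun x => crd x k) p (delta_mx (inord k.-1) ord0).
Proof. exact: strict_gradient_coord. Qed.

Lemma ft_derivative (C : numClosedFieldType) N (t : C) (p : 'rV[C]_N.+1) :
  differentiable (@ft C N t) p /\ forall v, 'D_v (@ft C N t) p =
    \sum_(1 <= i < N) 2 * crd p i * crd v i
    + (3 * crd p N ^+ 2 - 3 * t ^+ 2 * crd p N.+1 ^+ 2) * crd v N
    + (4 * crd p N.+1 ^+ 3 - 6 * t ^+ 2 * crd p N * crd p N.+1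
       - 6 * t ^+ 3 * crd p N.+1 ^+ 2) * crd v N.+1.
Proof.
have sa := strict_gradient_crd p N; have sb := strict_gradient_crd p N.+1.
have sS := @strict_gradient_sum _ _ p _ (index_iota 1 N) xpredT _ _
  (fun i _ => strict_gradientX 2 (strict_gradient_crd p i)).
have sf0 := strict_gradientD (strict_gradientD sS (strict_gradientX 3 sa))
  (strict_gradientX 4 sb).
have s1 := strict_gradientM (strict_gradientM (strict_gradient_cst p (3 * t ^+ 2)) sa)
  (strict_gradientX 2 sb).
have s2 := strict_gradientM (strict_gradient_cst p (2 * t ^+ 3)) (strict_gradientX 3 sb).
have sf := strict_gradientD (strict_gradientD sf0 (strict_gradientN s1)) (strict_gradientN s2).
have [df dE] := strict_gradient_diff sf; split => // v.
rewrite deriveE// dE !row_form_gradE row_form_grad_sum.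
under eq_bigr do rewrite !row_form_gradE -/(crd v _).
rewrite -!/(crd v _); under eq_bigr do rewrite expr1.
move: (\sum_(_ <= _ < _) _) => s; ring.
Qed.

Lemma ord_cases N (j : 'I_N.+2) :
  [\/ (j < N)%N, j = inord N | j = inord N.+1].
Proof.
case: (ltngtP j N) => h; first by constructor 1.
  constructor 3; apply: val_inj; rewrite /= inordK//; apply/eqP.
  by rewrite eqn_leq h -ltnS ltn_ord.
by constructor 2; apply: val_inj; rewrite /= inordK.
Qed.

Lemma crd_ord (C : numClosedFieldType) N (x : 'rV[C]_N.+1) (j : 'I_N.+1) :
  x ord0 j = crd x j.+1.
Proof. by rewrite /crd /= inord_val. Qed.

Lemma row_eq0 (C : numClosedFieldType) N (x : 'rV[C]_N.+2) :
  (forall i, (1 <= i < N.+1)%N -> crd x i = 0) -> crd x N.+1 = 0 ->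
  crd x N.+2 = 0 -> x = 0.
Proof.
move=> x0 xa xb; apply/rowP => j; rewrite mxE crd_ord.
case: (ord_cases j) => [jN|->|->]; first exact: x0.
  by rewrite inordK.
by rewrite inordK.
Qed.

(** The derivative along a is 3 (a - t b) (a + t b).  On a + t b = 0 the derivative
along b is 4 b^3, so b = 0.  On a = t b it is 4 b^2 (b - 3 t^3), and the point
with b = 3 t^3 is off the hypersurface, since f_t is b^3 (b - 4 t^3) there. *)
Lemma ft_singular_locus (C : numClosedFieldType) N (t : C) : t != 0 ->
  singular_locus (@ft C N.+1 t) = [set 0].
Proof.
move=> t0; apply/seteqP; split => [p [fp dp]|_ ->] /=.
  have {}dp i : 'D_(delta_mx ord0 i) (@ft C N.+1 t) p = 0 by exact: dp.
  pose e k : 'rV[C]_N.+2 := delta_mx ord0 (inord k.-1).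
  have eE k l : (1 <= k <= N.+2)%N -> (1 <= l <= N.+2)%N -> crd (e k) l = (l == k)%:R.
    case: k l => [|k] [|l]// kN lN; rewrite /crd /e mxE eqxx /=; congr (nat_of_bool _)%:R.
    by rewrite -(inj_eq val_inj) /= !inordK.
  (* Testing the derivative on the coordinate vector e k leaves one term. *)
  have others k : (1 <= k <= N.+2)%N ->
      \sum_(1 <= i < N.+1 | i != k) 2 * crd p i * crd (e k) i = 0.
    move=> kN; rewrite big_nat_cond big1// => i /andP[/andP[i1 iN] ik].
    by rewrite eE ?(negPf ik) ?mulr0// i1 leqW// ltnW.
  have dE k : (1 <= k <= N.+2)%N -> (if (k < N.+1)%N then 2 * crd p k else 0)
      + (3 * crd p N.+1 ^+ 2 - 3 * t ^+ 2 * crd p N.+2 ^+ 2) * (N.+1 == k)%:R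
    + (4 * crd p N.+2 ^+ 3 - 6 * t ^+ 2 * crd p N.+1 * crd p N.+2
       - 6 * t ^+ 3 * crd p N.+2 ^+ 2) * (N.+2 == k)%:R = 0.
    move=> kN; have := dp (inord k.-1); rewrite (ft_derivative t p).2 -/(e k).
    rewrite !eE ?leqnSn ?leqnn//; congr (_ + _ + _ = 0).
    have [kN1|kN1] := ltnP.
      rewrite (bigD1_seq k)//= ?iota_uniq//; last first.
        by rewrite mem_index_iota kN1; case/andP: kN => ->.
      by rewrite others// addr0 eE// eqxx mulr1.
    rewrite -[RHS](others k kN) big_nat_cond [RHS]big_nat_cond; apply: eq_bigl => i.
    rewrite andbT; case: (boolP (_ <= i < _)%N) => //= /andP[_ iN].
    by rewrite ltn_eqF// (leq_trans iN).
  have p0 i : (1 <= i < N.+1)%N -> crd p i = 0.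
    move=> /andP[i1 iN]; have := dE i; rewrite i1 iN ltnW 1?ltnW// => /(_ isT).
    rewrite gtn_eqF// gtn_eqF 1?ltnW// !mulr0 !addr0 => /eqP.
    by rewrite mulf_eq0 pnatr_eq0/= => /eqP.
  have := dE N.+1; rewrite leqnSn ltnn eqxx [N.+2 == _]gtn_eqF//.
  rewrite mulr1 mulr0 add0r addr0 => /(_ isT) ea.
  have := dE N.+2; rewrite leqnn [(N.+2 < _)%N]ltnNge leqnSn eqxx ltn_eqF//=.
  rewrite mulr0 mulr1 !add0r => /(_ isT) eb.
  have := fp; rewrite /ft /f0 (eq_big_nat _ _ (F2 := fun=> 0)); last first.
    by move=> i /p0 ->; rewrite expr0n.
  rewrite sumr_const_nat mul0rn add0r.
  set a := crd p N.+1 in ea eb *; set b := crd p N.+2 in ea eb * => f_eq.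
  suff b0 : b = 0.
    apply: row_eq0 => //; apply/eqP; rewrite -/a.
    by move: ea => /eqP; rewrite b0 expr0n mulr0 subr0 mulf_eq0 pnatr_eq0/= sqrf_eq0.
  have : (a - t * b) * (a + t * b) = 0.
    apply: (mulfI (_ : 3 != 0)); first by rewrite pnatr_eq0.
    by rewrite mulr0 -ea; ring.
  move=> /eqP; rewrite mulf_eq0 subr_eq0 addr_eq0 => /orP[]/eqP aE.
    have h1 : b ^+ 2 * (b - 3 * t ^+ 3) = 0.
      apply: (mulfI (_ : 4 != 0)); first by rewrite pnatr_eq0.
      by rewrite mulr0 -eb aE; ring.
    have h2 : b ^+ 3 * (b - 4 * t ^+ 3) = 0 by rewrite -f_eq aE; ring.
    apply/eqP; move: h1 => /eqP; rewrite mulf_eq0 sqrf_eq0 subr_eq0 => /orP[//|/eqP bE].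
    move: h2 => /eqP; rewrite mulf_eq0 expf_eq0/= => /orP[//|].
    have -> : b - 4 * t ^+ 3 = - t ^+ 3 by rewrite bE; ring.
    by rewrite oppr_eq0 expf_eq0/= (negPf t0).
  have : 4 * b ^+ 3 = 0 by rewrite -eb aE; ring.
  by move=> /eqP; rewrite mulf_eq0 pnatr_eq0 expf_eq0/= => /eqP.
have z k : crd (0 : 'rV[C]_N.+2) k = 0 by rewrite /crd mxE.
split => [|i].
  rewrite /ft /f0 !z (eq_bigr (fun=> 0)) => [|j _]; last by rewrite z expr0n.
  by rewrite sumr_const_nat mul0rn; ring.
rewrite (ft_derivative t 0).2 !z (eq_bigr (fun=> 0)) => [|j _]; last first.
  by rewrite z mulr0 mul0r.
by rewrite sumr_const_nat mul0rn; ring.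
Qed.

(** * A rational parametrization of the normal form *)

(** Notation for the origin of the formulas: s = tau + 2 t, p = tau + t,
q = tau + 3 t, r = tau + 4 t, and S for the second factor of param_y.  With
b = - tau q^2, the cubic g in a has the root s b, and a = s b + p q^3 z / 3
gives, after completing the square,
g = p^2 q^8 (z / 3) (3 S^2 + r (72 s - r z) / 72 * (z / 6)^3).
Setting r (72 s - r z) = 144 om^2 and solving for z gives param_z; the
rescaling y = 18 S / om then yields g = (p q^4 om / 18)^2 (y^2 z + z^4). *)
Section ParametrizedNormalForm.
Variables (C : numClosedFieldType) (t : C).
Implicit Types tau om : C.

Definition param_z tau om : C :=
  72 * ((tau + 2 * t) * (tau + 4 * t) - 2 * om ^+ 2) * ((tau + 4 * t) ^+ 2)^-1.

Definition param_b tau : C := - (tau * (tau + 3 * t) ^+ 2).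

Definition param_a tau om : C :=
  (tau + t) * (tau + 3 * t) ^+ 3 * 3^-1 * param_z tau om + (tau + 2 * t) * param_b tau.

Definition param_y tau om : C :=
  18 * om^-1 * (- tau + (tau + 2 * t) * 6^-1 * param_z tau om
                - (tau + 4 * t) * 216^-1 * param_z tau om ^+ 2).

Definition param_unit tau om : C := (tau + t) * (tau + 3 * t) ^+ 4 * om * 18^-1.

Lemma param_normal_form tau om : tau + 4 * t != 0 -> om != 0 ->
  param_a tau om ^+ 3 + param_b tau ^+ 4
    - 3 * t ^+ 2 * param_a tau om * param_b tau ^+ 2 - 2 * t ^+ 3 * param_b tau ^+ 3
  = param_unit tau om ^+ 2
    * (param_y tau om ^+ 2 * param_z tau om + param_z tau om ^+ 4).
Proof.
move=> r0 om0; rewrite /param_a /param_b /param_y /param_unit /param_z.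
by field; rewrite r0 om0.
Qed.

(** The explicit gradients at the point tau = 0, om = 2 t are what decides whether
the charts built from these functions are invertible there. *)
Section Gradients.
Variables (n : nat) (i j : 'I_n).
Implicit Types x : 'rV[C]_n.
Let tau x := x ord0 i.
Let om x := x ord0 j.
Let dtau : 'cV[C]_n := delta_mx i ord0.
Let dom : 'cV[C]_n := delta_mx j ord0.

Let strict_shift x k :
  strict_gradient (fun y => tau y + k * t) x (dtau + 0).
Proof. exact: strict_gradientD (strict_gradient_coord x i) (strict_gradient_cst x _). Qed.

Lemma strict_gradient_param_b x :
  exists2 g, strict_gradient (fun y => param_b (tau y)) x g &
    tau x = 0 -> g = (- 9 * t ^+ 2) *: dtau.
Proof.
eexists.
  apply: strict_gradientN; apply: strict_gradientM (strict_gradient_coord x i) _.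
  exact: strict_gradientX (strict_shift x 3).
move=> x0; apply/colP => k; rewrite !mxE -/(tau x) x0 /=; ring.
Qed.

Lemma strict_gradient_param_z x : tau x + 4 * t != 0 ->
  exists2 g, strict_gradient (fun y => param_z (tau y) (om y)) x g &
    t != 0 -> tau x = 0 -> om x = 2 * t ->
    g = (27 / t) *: dtau - (36 / t) *: dom.
Proof.
move=> r0; eexists.
  apply: strict_gradientM.
    apply: strict_gradientM (strict_gradient_cst x _) _.
    apply: strict_gradientD (strict_gradientM (strict_shift x 2) (strict_shift x 4)) _.
    apply: strict_gradientN; apply: strict_gradientM (strict_gradient_cst x _) _.
    exact: strict_gradientX (strict_gradient_coord x j).
  apply: strict_gradientV; last exact: strict_gradientX (strict_shift x 4).
  by rewrite expf_neq0.
move=> t0 x0 x1; apply/colP => k; rewrite !mxE -/(tau x) -/(om x) x0 x1 /=.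
by field.
Qed.

Lemma strict_gradient_param_a x : tau x + 4 * t != 0 ->
  exists2 g, strict_gradient (fun y => param_a (tau y) (om y)) x g &
    t != 0 -> tau x = 0 -> om x = 2 * t ->
    g = (225 * t ^+ 3) *: dtau - (324 * t ^+ 3) *: dom.
Proof.
move=> r0; have [gz sz gzE] := strict_gradient_param_z r0.
have [gb sb gbE] := strict_gradient_param_b x.
eexists.
  apply: strict_gradientD.
    apply: strict_gradientM sz; apply: strict_gradientM (strict_gradient_cst x _).
    apply: strict_gradientM (strict_gradientX 3 (strict_shift x 3)).
    exact: strict_gradientD (strict_gradient_coord x i) (strict_gradient_cst x _).
  exact: strict_gradientM (strict_shift x 2) sb.
move=> t0 x0 x1; rewrite gzE// gbE//; apply/colP => k.
rewrite !mxE -/(tau x) x0 x1 /param_z /param_b /=.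
by field.
Qed.

Lemma strict_gradient_param_y x : tau x + 4 * t != 0 -> om x != 0 ->
  exists2 g, strict_gradient (fun y => param_y (tau y) (om y)) x g &
    t != 0 -> tau x = 0 -> om x = 2 * t ->
    g = (72 / t) *: dtau - (108 / t) *: dom.
Proof.
move=> r0 om0; have [gz sz gzE] := strict_gradient_param_z r0.
eexists.
  apply: strict_gradientM.
    apply: strict_gradientM (strict_gradient_cst x _) _.
    exact: strict_gradientV om0 (strict_gradient_coord x j).
  apply: strict_gradientD.
    apply: strict_gradientD (strict_gradientN (strict_gradient_coord x i)) _.
    apply: strict_gradientM sz.
    exact: strict_gradientM (strict_shift x 2) (strict_gradient_cst x _).
  apply: strict_gradientN; apply: strict_gradientM (strict_gradientX 2 sz).
  exact: strict_gradientM (strict_shift x 4) (strict_gradient_cst x _).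
move=> t0 x0 x1; rewrite gzE//; apply/colP => k.
rewrite !mxE -/(tau x) -/(om x) x0 x1 /param_z /=.
by field.
Qed.

Lemma strict_gradient_param_unit x :
  exists g, strict_gradient (fun y => param_unit (tau y) (om y)) x g.
Proof.
eexists; apply: strict_gradientM (strict_gradient_cst x _).
apply: strict_gradientM (strict_gradient_coord x j).
apply: strict_gradientM (strict_gradientX 4 (strict_shift x 3)).
exact: strict_gradientD (strict_gradient_coord x i) (strict_gradient_cst x _).
Qed.

End Gradients.
End ParametrizedNormalForm.

(** * The two charts *)

(** Two charts f1, f2 with a common domain U yield the transition map between
their images. *)
Lemma biholomorphism_comp (C : numClosedFieldType) (V W X : normedModType C)
    (U : set V) (U1 : set W) (U2 : set X) f1 g1 f2 g2 :
  biholomorphism U U1 f1 g1 -> biholomorphism U U2 f2 g2 ->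
  biholomorphism U1 U2 (f2 \o g1) (f1 \o g2).
Proof.
move=> [[oU oU1] [hf1 hg1] [f1U g1U] [fg1 gf1]] [[_ oU2] [hf2 hg2] [f2U g2U] [fg2 gf2]].
split; [by []|split|split|split] => x Ux /=.
- by apply: differentiable_comp; [exact: hg1|apply: hf2; exact: g1U].
- by apply: differentiable_comp; [exact: hg2|apply: hf1; exact: g2U].
- by apply: f2U; exact: g1U.
- by apply: f1U; exact: g2U.
- by rewrite fg2 ?gf1//; exact: g1U.
- by rewrite fg1 ?gf2//; exact: g2U.
Qed.

(** The entries of h are numbered from 1, as the coordinates crd are. *)
Definition tail_row (C : numClosedFieldType) N (h : nat -> C) (a b : C) : 'rV[C]_N.+2 :=
  \row_(j < N.+2) (if (j < N)%N then h j.+1 else if j == N :> nat then a else b).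

Lemma crd_tail_row (C : numClosedFieldType) N (h : nat -> C) a b :
  [/\ forall i, (1 <= i < N.+1)%N -> crd (tail_row N h a b) i = h i,
      crd (tail_row N h a b) N.+1 = a & crd (tail_row N h a b) N.+2 = b].
Proof.
rewrite /crd; split => [[|i]//= iN||]; rewrite mxE inordK ?ltnn ?eqxx//.
- by rewrite -ltnS iN.
- exact: leqW (ltnW _).
- by rewrite /= ltnNge leqnSn gtn_eqF.
Qed.

Section Charts.
Variables (C : numClosedFieldType) (N : nat) (t : C).
Local Notation V := 'rV[C]_N.+2.
Implicit Types y : V.

(** The first coordinates carry the factor param_unit so that the same unit
param_unit ^+ 2 multiplies all terms of the normal form. *)
Definition source_chart y : V :=
  tail_row N (fun i => param_unit t (crd y N.+1) (crd y N.+2) * crd y i)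
    (param_a t (crd y N.+1) (crd y N.+2)) (param_b t (crd y N.+1)).

Definition target_chart y : V :=
  tail_row N (crd y) (param_y t (crd y N.+1) (crd y N.+2))
    (param_z t (crd y N.+1) (crd y N.+2)).

Definition chart_center : V := tail_row N (fun=> 0) 0 (2 * t).

Lemma charts_normal_form y : crd y N.+1 + 4 * t != 0 -> crd y N.+2 != 0 ->
  ft t (source_chart y)
  = param_unit t (crd y N.+1) (crd y N.+2) ^+ 2 * D_form 5 (target_chart y).
Proof.
move=> r0 om0; rewrite /ft /f0 /D_form.
have [Ai Aa Ab] := crd_tail_row N
  (fun i => param_unit t (crd y N.+1) (crd y N.+2) * crd y i)
  (param_a t (crd y N.+1) (crd y N.+2)) (param_b t (crd y N.+1)).
have [Bi Ba Bb] := crd_tail_row N (crd y)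
  (param_y t (crd y N.+1) (crd y N.+2)) (param_z t (crd y N.+1) (crd y N.+2)).
rewrite Aa Ab Ba Bb (eq_big_nat _ _ (F2 := fun i =>
  param_unit t (crd y N.+1) (crd y N.+2) ^+ 2 * crd y i ^+ 2)); last first.
  by move=> i iN; rewrite Ai// exprMn.
rewrite -mulr_sumr [in RHS](eq_big_nat _ _ (F2 := fun i => crd y i ^+ 2)); last first.
  by move=> i iN; rewrite Bi.
have nf := param_normal_form r0 om0.
rewrite -[in RHS]addrA [in RHS]mulrDr -[(5 - 1)%N]/4%N. rewrite -nf.
by move: (\sum_(_ <= _ < _) _) => S; ring.
Qed.

Lemma center_crd : [/\ forall i, (1 <= i < N.+1)%N -> crd chart_center i = 0,
  crd chart_center N.+1 = 0 & crd chart_center N.+2 = 2 * t].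
Proof. exact: crd_tail_row. Qed.

Lemma param_z_center : param_z t 0 (2 * t) = 0.
Proof.
have -> : param_z t 0 (2 * t) = 0 * ((0 + 4 * t) ^+ 2)^-1.
  by rewrite /param_z; congr (_ * _); ring.
exact: mul0r.
Qed.

Lemma source_chart_center : source_chart chart_center = 0.
Proof.
have [ci ca cb] := center_crd; rewrite /source_chart ca cb.
have [Ai Aa Ab] := crd_tail_row N (fun i => param_unit t 0 (2 * t) * crd chart_center i)
  (param_a t 0 (2 * t)) (param_b t 0).
apply: row_eq0 => [i iN||]; first by rewrite Ai// ci// mulr0.
  by rewrite Aa /param_a param_z_center /param_b; ring.
by rewrite Ab /param_b; ring.
Qed.

Lemma target_chart_center : target_chart chart_center = 0.
Proof.
have [ci ca cb] := center_crd; rewrite /target_chart ca cb.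
have [Ai Aa Ab] := crd_tail_row N (crd chart_center)
  (param_y t 0 (2 * t)) (param_z t 0 (2 * t)).
apply: row_eq0 => [i iN||]; first by rewrite Ai// ci.
  by rewrite Aa /param_y param_z_center; ring.
by rewrite Ab param_z_center.
Qed.

Lemma strict_gradient_tail_row (h : nat -> V -> C) (a b : V -> C) y
    (P : 'I_N.+2 -> 'cV[C]_N.+2 -> Prop) :
  (forall j : 'I_N.+2, (j < N)%N -> exists2 g, strict_gradient (h j.+1) y g & P j g) ->
  (exists2 g, strict_gradient a y g & P (inord N) g) ->
  (exists2 g, strict_gradient b y g & P (inord N.+1) g) ->
  exists g : 'I_N.+2 -> 'cV[C]_N.+2, forall j,
    strict_gradient (fun x => tail_row N (h ^~ x) (a x) (b x) ord0 j) y (g j) /\ P j (g j).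
Proof.
move=> sh [ga sa Pa] [gb sb Pb].
suff /choice[g gP] : forall j, exists g, strict_gradient
    (fun x => tail_row N (h ^~ x) (a x) (b x) ord0 j) y g /\ P j g by exists g.
move=> j; case: (ord_cases j) => [jN|->|->].
- have [g sg Pg] := sh j jN; exists g; split => //.
  by under eq_fun do rewrite mxE jN.
- by exists ga; split => //; under eq_fun do rewrite mxE inordK// ltnn eqxx.
exists gb; split => //.
by under eq_fun do rewrite mxE inordK// ltnNge leqnSn gtn_eqF//=.
Qed.

Lemma row_form_crd k (v : V) : row_form (delta_mx (inord k.-1) ord0) v = crd v k.
Proof. exact: row_formE. Qed.

(** At the centre the differential is triangular up to order: b depends only on
tau, and a on om with coefficient - 324 t^3. *)
Lemma source_gradients y : crd y N.+1 + 4 * t != 0 ->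
  exists g : 'I_N.+2 -> 'cV[C]_N.+2,
  (forall j, strict_gradient (fun x => source_chart x ord0 j) y (g j)) /\
  (t != 0 -> y = chart_center -> forall v, (forall j, row_form (g j) v = 0) -> v = 0).
Proof.
move=> r0; pose d (v : V) : V := tail_row N (fun i => 9 * t ^+ 6 * crd v i)
  (225 * t ^+ 3 * crd v N.+1 - 324 * t ^+ 3 * crd v N.+2)
  (- 9 * t ^+ 2 * crd v N.+1).
pose P (j : 'I_N.+2) g := t != 0 -> y = chart_center ->
  forall v, row_form g v = d v ord0 j.
have [ci ca cb] := center_crd.
have dE (v : V) := crd_tail_row N (fun i => 9 * t ^+ 6 * crd v i)
  (225 * t ^+ 3 * crd v N.+1 - 324 * t ^+ 3 * crd v N.+2)
  (- 9 * t ^+ 2 * crd v N.+1).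
have [g gP] : exists g : 'I_N.+2 -> 'cV[C]_N.+2, forall j,
    strict_gradient (fun x => source_chart x ord0 j) y (g j) /\ P j (g j).
  apply: strict_gradient_tail_row => [j jN||].
  - have [gk sk] := strict_gradient_param_unit t (inord N) (inord N.+1) y.
    eexists; first exact: strict_gradientM sk (strict_gradient_crd y j.+1).
    move=> t0 yE v; rewrite row_form_gradD !row_form_gradZ row_form_crd.
    have [di _ _] := dE v; rewrite (crd_ord (d v)) di// yE ci// mul0r addr0.
    rewrite -/(crd chart_center N.+1) -/(crd chart_center N.+2) ca cb.
    by congr (_ * _); rewrite /param_unit; field.
  - have [g sg gE] := strict_gradient_param_a (i := inord N) (inord N.+1) r0.
    exists g => // t0 yE v; rewrite gE ?yE//.
    have [_ da _] := dE v; rewrite -/(crd (d v) N.+1) da.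
    by rewrite !row_form_gradE.
  - have [g sg gE] := strict_gradient_param_b t (inord N) y.
    exists g => // t0 yE v; rewrite gE ?yE//.
    have [_ _ db] := dE v; rewrite -/(crd (d v) N.+2) db.
    by rewrite !row_form_gradE.
exists g; split => [j|t0 yE v gv]; first exact: (gP j).1.
have [di da db] := dE v.
have d0 k : crd (d v) k = 0 by rewrite /crd -((gP _).2 t0 yE v); exact: gv.
have va : crd v N.+1 = 0.
  apply: (mulfI (_ : - 9 * t ^+ 2 != 0)).
    by rewrite mulf_neq0 ?expf_neq0// oppr_eq0 pnatr_eq0.
  by rewrite -db d0 mulr0.
apply: row_eq0 => // [i iN|].
  apply: (mulfI (_ : 9 * t ^+ 6 != 0)).
    by rewrite mulf_neq0 ?expf_neq0 ?pnatr_eq0.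
  by rewrite -di// d0 mulr0.
have eb := d0 N.+1; rewrite da va mulr0 sub0r in eb.
apply: (mulfI (_ : - (324 * t ^+ 3) != 0)).
  by rewrite oppr_eq0 mulf_neq0 ?expf_neq0 ?pnatr_eq0.
by rewrite mulNr eb mulr0.
Qed.

(** At the centre the differentials of y and z are proportional to 2 dtau - 3 dom
and 3 dtau - 4 dom, which are independent. *)
Lemma target_gradients y : crd y N.+1 + 4 * t != 0 -> crd y N.+2 != 0 ->
  exists g : 'I_N.+2 -> 'cV[C]_N.+2,
  (forall j, strict_gradient (fun x => target_chart x ord0 j) y (g j)) /\
  (t != 0 -> y = chart_center -> forall v, (forall j, row_form (g j) v = 0) -> v = 0).
Proof.
move=> r0 om0; pose d (v : V) : V := tail_row N (crd v)
  (72 / t * crd v N.+1 - 108 / t * crd v N.+2)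
  (27 / t * crd v N.+1 - 36 / t * crd v N.+2).
pose P (j : 'I_N.+2) g := t != 0 -> y = chart_center ->
  forall v, row_form g v = d v ord0 j.
have [ci ca cb] := center_crd.
have dE (v : V) := crd_tail_row N (crd v)
  (72 / t * crd v N.+1 - 108 / t * crd v N.+2)
  (27 / t * crd v N.+1 - 36 / t * crd v N.+2).
have [g gP] : exists g : 'I_N.+2 -> 'cV[C]_N.+2, forall j,
    strict_gradient (fun x => target_chart x ord0 j) y (g j) /\ P j (g j).
  apply: (@strict_gradient_tail_row (fun k x => crd x k)) => [j jN||].
  - eexists; first exact: strict_gradient_crd y j.+1.
    move=> t0 yE v; rewrite row_form_crd.
    by have [di _ _] := dE v; rewrite (crd_ord (d v)) di.
  - have [g sg gE] := strict_gradient_param_y (i := inord N) (j := inord N.+1) r0 om0.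
    exists g => // t0 yE v; rewrite gE ?yE//.
    have [_ da _] := dE v; rewrite -/(crd (d v) N.+1) da.
    by rewrite !row_form_gradE.
  - have [g sg gE] := strict_gradient_param_z (i := inord N) (inord N.+1) r0.
    exists g => // t0 yE v; rewrite gE ?yE//.
    have [_ _ db] := dE v; rewrite -/(crd (d v) N.+2) db.
    by rewrite !row_form_gradE.
exists g; split => [j|t0 yE v gv]; first exact: (gP j).1.
have [di da db] := dE v.
have d0 k : crd (d v) k = 0 by rewrite /crd -((gP _).2 t0 yE v); exact: gv.
have ea := d0 N.+1; have eb := d0 N.+2; rewrite da in ea; rewrite db in eb.
apply: row_eq0 => [i iN||]; first by rewrite -di// d0.
  (* Eliminate om, then tau, between the two linear equations. *)
  transitivity (t / 36 * (3 * (27 / t * crd v N.+1 - 36 / t * crd v N.+2)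
    - (72 / t * crd v N.+1 - 108 / t * crd v N.+2)) * 4); first by field.
  by rewrite ea eb; ring.
transitivity (t / 36 * (8 / 3 * (27 / t * crd v N.+1 - 36 / t * crd v N.+2)
    - (72 / t * crd v N.+1 - 108 / t * crd v N.+2)) * 3); first by field.
by rewrite ea eb; ring.
Qed.
End Charts.

(** * The equivalence with the normal form *)

(** Both charts are inverted on one ball around the centre, small enough for all
denominators and the unit to be nonzero on it. *)
Lemma ft_germ_D5 (R : realType) (N : nat) (t : Cplx R) : t != 0 ->
  germ_equivalent (@ft (Cplx R) N.+1 t) 0 (D_form 5) 0.
Proof.
move=> t0; set y0 := chart_center N t.
have [ci ca cb] := center_crd N t.
have sr (y : 'rV[Cplx R]_N.+2) : strict_gradient (fun x => crd x N.+1 + 4 * t) y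
    (delta_mx (inord N) ord0 + 0).
  exact: strict_gradientD (strict_gradient_crd y N.+1) (strict_gradient_cst y _).
have r0 : crd y0 N.+1 + 4 * t != 0 by rewrite ca add0r mulf_neq0// pnatr_eq0.
have om0 : crd y0 N.+2 != 0 by rewrite cb mulf_neq0// pnatr_eq0.
pose k (y : 'rV[Cplx R]_N.+2) := param_unit t (crd y N.+1) (crd y N.+2).
have sk (y : 'rV[Cplx R]_N.+2) := strict_gradient_param_unit t (inord N) (inord N.+1) y.
have k0 : k y0 != 0.
  rewrite /k ca cb /param_unit !add0r.
  by rewrite !mulf_neq0 ?invr_eq0 ?expf_neq0 ?mulf_neq0 ?pnatr_eq0.
have nr := strict_gradient_near_neq0 (sr y0) r0.
have nom := strict_gradient_near_neq0 (strict_gradient_crd y0 N.+2) om0.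
have nk : \forall y \near (y0 : 'rV[Cplx R]_N.+2), k y != 0.
  by have [g sg] := sk y0; exact: strict_gradient_near_neq0 sg k0.
have [e e0 eP] := near_ball (filterI nk (filterI nr nom)).
have [gA [sA iA]] := source_gradients (y := y0) r0.
have [gB [sB iB]] := target_gradients (y := y0) r0 om0.
have [rA rA0 HA] : exists2 r1, 0 < r1 & forall r, 0 < r -> r <= r1 -> exists psi,
    biholomorphism (ball y0 r) (source_chart t @` ball y0 r) (source_chart t) psi.
  apply: (local_inverse_entries sA) => [v|]; first exact: iA.
  by apply: filterS nr => y yr j; have [g [sg _]] := source_gradients yr; exists (g j).
have [rB rB0 HB] : exists2 r1, 0 < r1 & forall r, 0 < r -> r <= r1 -> exists psi,
    biholomorphism (ball y0 r) (target_chart t @` ball y0 r) (target_chart t) psi.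
  apply: (local_inverse_entries sB) => [v|]; first exact: iB.
  apply: filterS2 nr nom => y yr yom j.
  by have [g [sg _]] := target_gradients yr yom; exists (g j).
have [m m0 [mA mB]] := lower_bound_pos rA0 rB0.
have [r r_gt0 [rm re]] := lower_bound_pos m0 e0.
have [alpha bA] := HA r r_gt0 (ltW (lt_trans rm mA)).
have [beta bB] := HB r r_gt0 (ltW (lt_trans rm mB)).
have By0 : ball y0 r y0 by exact: ballxx.
have BP y : ball y0 r y -> [/\ k y != 0, crd y N.+1 + 4 * t != 0 & crd y N.+2 != 0].
  rewrite -ball_normE /ball_/= distrC => yr.
  by have [? []] := eP y (lt_trans yr re).
have [_ [_ hol_alpha] [AU alphaU] [alphaK Aalpha]] := bA.
exists (source_chart t @` ball y0 r), (target_chart t @` ball y0 r),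
  (target_chart t \o alpha), (source_chart t \o beta), (fun x => k (alpha x) ^+ 2).
split.
- by exists y0 => //; exact: source_chart_center.
- have alpha0 := alphaK y0 By0; rewrite source_chart_center in alpha0.
  by rewrite /= alpha0 target_chart_center.
- exact: biholomorphism_comp bA bB.
- split=> x Ux; last by have [kx _ _] := BP _ (alphaU _ Ux); exact: expf_neq0.
  apply: (@differentiable_comp _ _ _ _ alpha (fun y => k y ^+ 2)); first exact: hol_alpha.
  have [g sg] := sk (alpha x).
  by have [] := strict_gradient_diff (strict_gradientX 2 sg).
move=> x Ux; have [_ rx omx] := BP _ (alphaU _ Ux).
by rewrite -[in LHS](Aalpha x Ux) charts_normal_form.
Qed.

Theorem mainTheorem8 (R : realType) (N : nat) (hN : (1 <= N)%N) :
  generically (fun t : Cplx R =>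
    singular_locus (@ft (Cplx R) N t) = [set 0] /\
    singularity_type_D 5 (@ft (Cplx R) N t) 0).
Proof.
case: N hN => // N _; exists 'X; first by rewrite polyX_eq0.
move=> t; rewrite rootX => t0; have sing := @ft_singular_locus (Cplx R) N t t0.
split=> //; split=> //; last exact: ft_germ_D5.
exists setT; split; [exact: openT|exact: I| |by rewrite setIT; exact: sing].
by move=> p _; exact: (ft_derivative t p).1.
Qed.
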